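(* Let $(G,E)$ be a pseudo-free self-similar graph, where $G$ is a (countable discrete) group containing an element of infinite order, and $E$ has finitely many vertices and no sources. The following statements are equivalent. (1) For every $g\in G$ and every $x\in E^\infty$, the path $x$ is either $g$-generic or $g$-rare. (2) Every subgroupoid $\mathcal{S}$ with $\mathcal{S}_{\mathrm{sym}}\subseteq\mathcal{S}\subseteq\operatorname{Iso}(\mathcal{G}_{G,E})^\circ$ is closed in $\mathcal{G}_{G,E}$. (3) The subgroupoid $\mathcal{S}_{\mathrm{sym}}$ is closed in $\mathcal{G}_{G,E}$.
   Context: Graphs. $\mathbb{N}=\{0,1,2,\dots\}$. A directed graph $E=(E^0,E^1,r,s)$ has vertex set $E^0$, edge set $E^1$, range and source maps $r,s\colon E^1\to E^0$. Throughout, graphs are finite ($E^0,E^1$ finite) and have no sources (every vertex is the range of some edge). A path of length $n\ge1$ is a word $e_1\cdots e_n$ of edges with $s(e_i)=r(e_{i+1})$, with range $r(e_1)$ and source $s(e_n)$; vertices are the paths of length $0$. $E^*$ is the set of finite paths, $|\mu|$ the length. $E^\infty$ is the set of infinite paths $x=e_1e_2\cdots$ ($s(e_i)=r(e_{i+1})$), $r(x)=r(e_1)$; $x(m,n)=e_{m+1}\cdots e_n$ for $m<n$, $x(n,n)=r(e_{n+1})$. $vE^\infty$ is the set of infinite paths with range $v$, $\mu E^\infty=\{\mu x:x\in s(\mu)E^\infty\}$; $E^\infty$ has the topology generated by the sets $\mu E^\infty$. Self-similar graph $(G,E)$: $G$ acts on $E^*$ by bijections preserving lengths and commuting with $r,s$,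 with a restriction map $G\times E^*\to G$, $(g,\mu)\mapsto g|_\mu$, such that $(gh)|_\mu=g|_{h\cdot\mu}h|_\mu$; $g|_v=g$ for $v\in E^0$; $1_G|_\mu=1_G$; $g|_{\mu\nu}=g|_\mu|_\nu$ and $g\cdot(\mu\nu)=(g\cdot\mu)(g|_\mu\cdot\nu)$ whenever $s(\mu)=r(\nu)$. The action extends to $E^\infty$ by $(g\cdot x)(p,q)=g|_{x(0,p)}\cdot x(p,q)$, and $g|_x\colon\mathbb{N}\to G$ is $p\mapsto g|_{x(0,p)}$. $(G,E)$ is pseudo-free if $g\cdot\mu=\mu$ and $g|_\mu=1_G$ imply $g=1_G$. Generic/rare. $x\in E^\infty$ is $g$-generic if either $g\cdot x\ne x$, or $g$ pointwise fixes a neighborhood of $x$. It is $g$-rare if $g\cdot x=x$ and there exists $N\in\mathbb{N}$ such that $g$ does not pointwise fix any neighborhood of any $z\in x(0,N)E^\infty$. Groupoid. $Q(\mathbb{N},G)$ is the group of functions $\mathbb{N}\to G$ (pointwise product) modulo eventual equality, $[f]$ the class of $f$. For $n\in\mathbb{Z}$, $\mathcal{T}_n(f)(p)=f(p-n)$ if $p\ge n$ and $1_G$ otherwise, inducing an automorphism $\mathcal{T}_n$ of $Q(\mathbb{N},G)$. Then $$\mathcal{G}_{G,E}=\{(\mu(g\cdot x);\mathcal{T}_{|\mu|}([g|_x]),|\mu|-|\nu|;\nu x): g\in G,\ \mu,\nu\in E^*,\ s(\mu)=g\cdot s(\nu),\ x\in s(\nu)E^\infty\}$$ with $r(x;[f],k;y)=(x;[1_G],0;x)$,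 $s(x;[f],k;y)=(y;[1_G],0;y)$, product $(x;[f],k;y)(y;[h],l;z)=(x;[f]\mathcal{T}_k([h]),k+l;z)$, inverse $(y;\mathcal{T}_{-k}([f]^{-1}),-k;x)$. Its topology is generated by the cylinder sets $\mathcal{Z}(\mu,g,\nu)=\{(\mu(g\cdot x);\mathcal{T}_{|\mu|}([g|_x]),|\mu|-|\nu|;\nu x):x\in s(\nu)E^\infty\}$ with $s(\mu)=g\cdot s(\nu)$. $\operatorname{Iso}(\mathcal{G})=\{\mathfrak g:r(\mathfrak g)=s(\mathfrak g)\}$, and $\operatorname{Iso}(\mathcal{G})^\circ$ is its interior in $\mathcal{G}$. Cycline triples. $(\mu,g,\nu)$ is a cycline triple if $s(\mu)=g\cdot s(\nu)$ and $\mu(g\cdot x)=\nu x$ for all $x\in s(\nu)E^\infty$; it is symmetric if $\mu=\nu$. $\mathcal{S}_{\mathrm{sym}}$ is the union of the sets $\mathcal{Z}(\mu,g,\mu)$ over all symmetric cycline triples. *)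

(* Defs.v *)
From HB Require Import structures.
From mathcomp Require Import all_boot all_order all_algebra.
From mathcomp Require Import all_classical.
From mathcomp Require Import topology zify.

Set Implicit Arguments.
Unset Strict Implicit.
Unset Printing Implicit Defensive.

Local Open Scope classical_set_scope.
Local Open Scope quotient_scope.

(** * Directed graphs and paths *)

Record digraph := Digraph {
  vert : finType;
  edge : finType;
  rg : edge -> vert;
  sc : edge -> vert }.

Definition no_sources (E : digraph) : Prop :=
  forall v : vert E, exists e : edge E, rg e = v.

Fixpoint is_path (E : digraph) (v : vert E) (w : seq (edge E)) : bool :=
  if w is e :: w' then (rg e == v) && is_path (sc e) w' else true.

(** A finite path is its range together with its word of edges, so that the
    vertices are exactly the paths with empty word. *)
Record epath (E : digraph) := EPath {
  prg : vert E;
  pword : seq (edge E);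
  pwordP : is_path prg pword }.

Arguments EPath {E} prg pword pwordP.

Definition psc (E : digraph) (mu : epath E) : vert E :=
  last (prg mu) (map (@sc E) (pword mu)).

Definition plen (E : digraph) (mu : epath E) : nat := size (pword mu).

Definition pvert (E : digraph) (v : vert E) : epath E :=
  EPath v [::] isT.

Lemma is_path_cat (E : digraph) (v : vert E) (w1 w2 : seq (edge E)) :
  is_path v (w1 ++ w2) =
  is_path v w1 && is_path (last v (map (@sc E) w1)) w2.
Proof. by elim: w1 v => //= e w1 IH v; rewrite IH andbA. Qed.

Lemma pcat_subproof (E : digraph) (mu nu : epath E) :
  psc mu = prg nu -> is_path (prg mu) (pword mu ++ pword nu).
Proof.
by move=> c; rewrite is_path_cat pwordP -/(psc mu) c pwordP.
Qed.

Definition pcat (E : digraph) (mu nu : epath E) (c : psc mu = prg nu) :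
  epath E := EPath (prg mu) (pword mu ++ pword nu) (pcat_subproof c).

(** ** Infinite paths; [x n] is the edge $e_{n+1}$ *)

Record ipath (E : digraph) := IPath {
  iedge :> nat -> edge E;
  iedgeP : forall n, sc (iedge n) = rg (iedge n.+1) }.

Arguments IPath {E} iedge iedgeP.

Definition irg (E : digraph) (x : ipath E) : vert E := rg (x 0).

Lemma is_path_seg (E : digraph) (x : ipath E) (m k : nat) :
  is_path (rg (x m)) (map x (iota m k)).
Proof. by elim: k m => //= k IH m; rewrite eqxx iedgeP IH. Qed.

(** $x(m,n)$; for $m = n$ this is the vertex $r(e_{n+1})$ *)
Definition seg (E : digraph) (x : ipath E) (m n : nat) : epath E :=
  EPath (rg (x m)) (map x (iota m (n - m))) (is_path_seg x m (n - m)).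

Definition icat_edge (E : digraph) (mu : epath E) (x : ipath E) (n : nat) :
  edge E :=
  if n < plen mu then nth (x 0) (pword mu) n else x (n - plen mu).

Lemma icat_subproof (E : digraph) (mu : epath E) (x : ipath E) :
  psc mu = irg x ->
  forall n, sc (icat_edge mu x n) = rg (icat_edge mu x n.+1).
Proof.
case: mu => v w; rewrite /psc /icat_edge /plen /= => vw c n.
elim: w v vw c n => [|e w IH] v /=.
  by move=> _ _ n; rewrite !subn0 iedgeP.
move=> /andP[_ ew] c [|n]; last by have := IH _ ew c n; rewrite !ltnS !subSS.
rewrite /= ltnS subSS.
by case: w ew c {IH} => [|f w] /=; [rewrite subn0|case/andP=> /eqP].
Qed.

Definition icat (E : digraph) (mu : epath E) (x : ipath E)
  (c : psc mu = irg x) : ipath E :=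
  IPath (icat_edge mu x) (icat_subproof c).

(** $\mu E^\infty$ *)
Definition pcyl (E : digraph) (mu : epath E) : set (ipath E) :=
  [set z | exists (x : ipath E) (c : psc mu = irg x), z = icat c].

HB.instance Definition _ (E : digraph) := gen_eqMixin (ipath E).
HB.instance Definition _ (E : digraph) := gen_choiceMixin (ipath E).
HB.instance Definition _ (E : digraph) :=
  @isSubBaseTopological.Build (ipath E) (set (ipath E)) (range (@pcyl E)) id.

(** * Self-similar graphs *)

(** The [exists] in [act_pcat] asserts that the right-hand side is a path,
    which is implicit in the usual formulation. *)
Record self_similar (G : groupType) (E : digraph) := SelfSimilar {
  act : G -> epath E -> epath E;
  res : G -> epath E -> G;
  act1 : forall mu, act 1%g mu = mu;
  actM : forall g h mu, act (g * h)%g mu = act g (act h mu);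
  act_len : forall g mu, plen (act g mu) = plen mu;
  act_rg : forall g mu, pvert (prg (act g mu)) = act g (pvert (prg mu));
  act_sc : forall g mu, pvert (psc (act g mu)) = act g (pvert (psc mu));
  resM : forall g h mu, res (g * h)%g mu = (res g (act h mu) * res h mu)%g;
  res_vert : forall g v, res g (pvert v) = g;
  res1 : forall mu, res 1%g mu = 1%g;
  res_pcat : forall g mu nu (c : psc mu = prg nu),
    res g (pcat c) = res (res g mu) nu;
  act_pcat : forall g mu nu (c : psc mu = prg nu),
    exists c' : psc (act g mu) = prg (act (res g mu) nu),
      act g (pcat c) = pcat c' }.

Section SelfSimilar.
Context {G : groupType} {E : digraph} (A : self_similar G E).

Definition vact (g : G) (v : vert E) : vert E := prg (act A g (pvert v)).

Lemma pvert_vact g v : pvert (vact g v) = act A g (pvert v).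
Proof. by rewrite /vact act_rg. Qed.

Lemma prg_act g mu : prg (act A g mu) = vact g (prg mu).
Proof. by rewrite /vact -act_rg. Qed.

Lemma psc_act g mu : psc (act A g mu) = vact g (psc mu).
Proof. by rewrite /vact -act_sc. Qed.

(** The edge $(g \cdot x)(n,n+1) = g|_{x(0,n)} \cdot x(n,n+1)$; the default
    [x n] of [head] is never used, as that path has length one. *)
Definition iact_edge (g : G) (x : ipath E) (n : nat) : edge E :=
  head (x n) (pword (act A (res A g (seg x 0 n)) (seg x n n.+1))).

Lemma pvert_inj : injective (@pvert E).
Proof. by move=> u v []. Qed.

Lemma iact_edgeE g (x : ipath E) n :
  pword (act A (res A g (seg x 0 n)) (seg x n n.+1)) = [:: iact_edge g x n].
Proof.
have := act_len A (res A g (seg x 0 n)) (seg x n n.+1).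
rewrite /iact_edge /plen /= subSnn /=.
by case: (pword _) => [|e []].
Qed.

Lemma rg_iact_edge g (x : ipath E) n :
  rg (iact_edge g x n) = vact (res A g (seg x 0 n)) (rg (x n)).
Proof.
have := pwordP (act A (res A g (seg x 0 n)) (seg x n n.+1)).
by rewrite iact_edgeE /= andbT prg_act => /eqP.
Qed.

Lemma sc_iact_edge g (x : ipath E) n :
  sc (iact_edge g x n) = vact (res A g (seg x 0 n)) (sc (x n)).
Proof.
have := psc_act (res A g (seg x 0 n)) (seg x n n.+1).
by rewrite {1}/psc iact_edgeE /= => ->; rewrite /psc /= subSnn.
Qed.

Lemma epath_eq (mu nu : epath E) :
  prg mu = prg nu -> pword mu = pword nu -> mu = nu.
Proof.
case: mu nu => [v w vw] [v' w' vw'] /= ev ew; subst.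
by congr EPath; apply: bool_irrelevance.
Qed.

Lemma ipath_eq (x y : ipath E) : x =1 y -> x = y.
Proof.
case: x y => [x xP] [y yP] /= /funext xy; subst.
by congr IPath; apply: Prop_irrelevance.
Qed.

Lemma psc_seg (x : ipath E) m n : m <= n -> psc (seg x m n) = rg (x n).
Proof.
move=> /subnK <-; rewrite /psc /= addnK.
by move: (n - m) => k; elim: k m => //= k IH m; rewrite iedgeP IH addnS addSn.
Qed.

Lemma pcat_seg (x : ipath E) m n p (mn : m <= n) (np : n <= p)
    (c : psc (seg x m n) = prg (seg x n p)) :
  pcat c = seg x m p.
Proof.
apply: epath_eq => //=; rewrite -map_cat.
have -> : p - m = (n - m) + (p - n) by rewrite addnC addnBA // subnK.
by rewrite iotaD subnKC.
Qed.

Lemma res_seg g (x : ipath E) n p : n <= p ->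
  res A g (seg x 0 p) = res A (res A g (seg x 0 n)) (seg x n p).
Proof.
move=> np; have c : psc (seg x 0 n) = prg (seg x n p) by rewrite psc_seg.
by rewrite -res_pcat pcat_seg.
Qed.

(** $g|_\mu$ acts on $s(\mu)$ as $g$ does. *)
Lemma vact_res g (mu : epath E) :
  vact (res A g mu) (psc mu) = vact g (psc mu).
Proof.
have c : psc mu = prg (pvert (psc mu)) by [].
by have [c' _] := act_pcat A g c; rewrite /vact -c' psc_act.
Qed.

Lemma iact_subproof g (x : ipath E) n :
  sc (iact_edge g x n) = rg (iact_edge g x n.+1).
Proof.
rewrite sc_iact_edge rg_iact_edge (res_seg _ _ (leqnSn n)) -iedgeP.
have <- : psc (seg x n n.+1) = sc (x n) by rewrite /psc /= subSnn.
by rewrite vact_res.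
Qed.

Definition iact (g : G) (x : ipath E) : ipath E :=
  IPath (iact_edge g x) (iact_subproof g x).

(** The defining property $(g \cdot x)(p,q) = g|_{x(0,p)} \cdot x(p,q)$ *)
Lemma seg_iact g (x : ipath E) p q : p <= q ->
  seg (iact g x) p q = act A (res A g (seg x 0 p)) (seg x p q).
Proof.
move=> /subnK <-; elim: (q - p) => [|k IH].
  apply: epath_eq; first by rewrite prg_act /= rg_iact_edge.
  rewrite /= subnn /=; apply/esym/size0nil.
  by rewrite -[size _]/(plen _) act_len /plen /= subnn.
have pk : p <= k + p by exact: leq_addl.
have c : psc (seg x p (k + p)) = prg (seg x (k + p) (k + p).+1).
  by rewrite psc_seg.
rewrite addSn -(pcat_seg pk (leqnSn _) c).
have [c' ->] := act_pcat A (res A g (seg x 0 p)) c.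
apply: epath_eq; first by rewrite /= prg_act /= rg_iact_edge.
rewrite /= -res_seg // iact_edgeE -IH /= -addSn !addnK.
by rewrite -addn1 iotaD map_cat /= addnC.
Qed.

Definition ires (g : G) (x : ipath E) : nat -> G :=
  fun p => res A g (seg x 0 p).

Definition pseudo_free : Prop :=
  forall g mu, act A g mu = mu -> res A g mu = 1%g -> g = 1%g.

Definition fixes_nbhd (g : G) (x : ipath E) : Prop :=
  exists2 U : set (ipath E), nbhs x U & forall z, U z -> iact g z = z.

Definition generic (g : G) (x : ipath E) : Prop :=
  iact g x <> x \/ fixes_nbhd g x.

Definition rare (g : G) (x : ipath E) : Prop :=
  iact g x = x /\
  exists N : nat, forall z, pcyl (seg x 0 N) z -> ~ fixes_nbhd g z.

End SelfSimilar.

(** * The group $Q(\mathbb{N},G)$ of germs at infinity *)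

Section Germs.
Variable G : groupType.

Definition eventually_eq (f h : nat -> G) : bool :=
  `[< \forall p \near \oo, f p = h p >].

Lemma eventually_eq_refl : reflexive eventually_eq.
Proof. by move=> f; apply/asboolP; near=> p. Unshelve. all: by end_near. Qed.

Lemma eventually_eq_sym : symmetric eventually_eq.
Proof.
by move=> f h; apply/asboolP/asboolP; apply: filterS => p ->.
Qed.

Lemma eventually_eq_trans : transitive eventually_eq.
Proof.
move=> h f k /asboolP fh /asboolP hk; apply/asboolP.
by apply: filterS2 fh hk => p -> ->.
Qed.

Canonical eventually_equiv := EquivRel eventually_eq
  eventually_eq_refl eventually_eq_sym eventually_eq_trans.

Definition germ := {eq_quot eventually_equiv}.

HB.instance Definition _ := Choice.on germ.

Definition germ_of (f : nat -> G) : germ := \pi_germ f.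

Lemma germP (f h : nat -> G) :
  germ_of f = germ_of h <-> \forall p \near \oo, f p = h p.
Proof.
split=> [/eqmodP /asboolP //|fh]; by apply/eqmodP/asboolP.
Qed.

Lemma germ_ofK (q : germ) : germ_of (repr q) = q.
Proof. exact: reprK. Qed.

Lemma germ_repr (f : nat -> G) : \forall p \near \oo, repr (germ_of f) p = f p.
Proof. by apply/germP; rewrite germ_ofK. Qed.

Definition germ_one : germ := germ_of (fun _ => 1%g).
Definition germ_mul (a b : germ) : germ :=
  germ_of (fun p => repr a p * repr b p)%g.
Definition germ_inv (a : germ) : germ := germ_of (fun p => (repr a p)^-1)%g.

Lemma germ_mulE f h :
  germ_mul (germ_of f) (germ_of h) = germ_of (fun p => f p * h p)%g.
Proof.
by apply/germP; apply: filterS2 (germ_repr f) (germ_repr h) => p -> ->.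
Qed.

Lemma germ_invE f : germ_inv (germ_of f) = germ_of (fun p => (f p)^-1)%g.
Proof. by apply/germP; apply: filterS (germ_repr f) => p ->. Qed.

Lemma germ_mulA : associative germ_mul.
Proof.
move=> a b c; rewrite -(germ_ofK a) -(germ_ofK b) -(germ_ofK c) !germ_mulE.
by congr germ_of; apply/funext => p; rewrite mulgA.
Qed.

Lemma germ_mul1 : left_id germ_one germ_mul.
Proof.
move=> a; rewrite -(germ_ofK a) germ_mulE.
by congr germ_of; apply/funext => p; rewrite mul1g.
Qed.

Lemma germ_mulr1 : right_id germ_one germ_mul.
Proof.
move=> a; rewrite -(germ_ofK a) germ_mulE.
by congr germ_of; apply/funext => p; rewrite mulg1.
Qed.

Lemma germ_mulV : left_inverse germ_one germ_inv germ_mul.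
Proof.
move=> a; rewrite -(germ_ofK a) germ_invE germ_mulE.
by congr germ_of; apply/funext => p; rewrite mulVg.
Qed.

Lemma germ_mulrV : right_inverse germ_one germ_inv germ_mul.
Proof.
move=> a; rewrite -(germ_ofK a) germ_invE germ_mulE.
by congr germ_of; apply/funext => p; rewrite mulgV.
Qed.

HB.instance Definition _ := isGroup.Build germ
  germ_mulA germ_mul1 germ_mulr1 germ_mulV germ_mulrV.

(** $\mathcal{T}_n(f)$ *)
Definition shift (n : int) (f : nat -> G) : nat -> G :=
  fun p => if (n <= p%:Z)%R then f `|(p%:Z - n)%R|%N else 1%g.

Definition germ_shift (n : int) (a : germ) : germ := germ_of (shift n (repr a)).

Lemma germ_shiftE n f : germ_shift n (germ_of f) = germ_of (shift n f).
Proof.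
apply/germP; have [N _ fN] := germ_repr f.
exists (N + `|n|) => // p /= Np; rewrite /shift; case: ifP => // np.
apply: fN => /=; lia.
Qed.

End Germs.

(** * The groupoid of a self-similar graph *)

Section Groupoid.
Context {G : groupType} {E : digraph} (A : self_similar G E).

(** Formal triples $(x; q, k; y)$ *)
Record triple := Triple {
  tl : ipath E;
  tgerm : germ G;
  tdeg : int;
  tr : ipath E }.

Definition tunit (x : ipath E) : triple := Triple x 1%g 0%R x.
Definition trg (t : triple) : triple := tunit (tl t).
Definition tsc (t : triple) : triple := tunit (tr t).
Definition tmul (t u : triple) : triple :=
  Triple (tl t) (tgerm t * germ_shift (tdeg t) (tgerm u))%g
    (tdeg t + tdeg u)%R (tr u).
Definition tinv (t : triple) : triple :=
  Triple (tr t) (germ_shift (- tdeg t)%R (tgerm t)^-1%g) (- tdeg t)%R (tl t).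

(** $\mathcal{Z}(\mu,g,\nu)$ as a set of triples *)
Definition tcyl (mu : epath E) (g : G) (nu : epath E) : set triple :=
  [set t | exists (x : ipath E) (c1 : psc mu = irg (iact A g x))
             (c2 : psc nu = irg x),
      t = Triple (icat c1)
                 (germ_shift (plen mu)%:Z (germ_of (ires A g x)))
                 ((plen mu)%:Z - (plen nu)%:Z)%R
                 (icat c2)].

Definition in_groupoid (t : triple) : Prop :=
  exists mu g nu, psc mu = vact A g (psc nu) /\ tcyl mu g nu t.

Record groupoid := Groupoid {
  gtriple :> triple;
  groupoidP : in_groupoid gtriple }.

Definition gcyl (mu : epath E) (g : G) (nu : epath E) : set groupoid :=
  [set a | tcyl mu g nu (gtriple a)].

Definition gcyls : set (set groupoid) :=
  [set Z | exists mu g nu, psc mu = vact A g (psc nu) /\ Z = gcyl mu g nu].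

End Groupoid.

Arguments gcyl {G E} A mu g nu _.
Arguments gcyls {G E} A _.

HB.instance Definition _ (G : groupType) (E : digraph)
  (A : self_similar G E) := gen_eqMixin (groupoid A).
HB.instance Definition _ (G : groupType) (E : digraph)
  (A : self_similar G E) := gen_choiceMixin (groupoid A).
HB.instance Definition _ (G : groupType) (E : digraph)
  (A : self_similar G E) :=
  @isSubBaseTopological.Build (groupoid A) (set (groupoid A)) (gcyls A) id.

Section Subgroupoids.
Context {G : groupType} {E : digraph} (A : self_similar G E).

Definition Iso : set (groupoid A) := [set a | trg a = tsc a].

(** The operations are the formulas on triples; closure under them includes
    that the resulting triple lies in the groupoid. Units of elements of [S]
    are then in [S]. *)
Definition subgroupoid (S : set (groupoid A)) : Prop :=
  (forall a b, S a -> S b -> tsc a = trg b ->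
     exists2 c, S c & gtriple c = tmul a b) /\
  (forall a, S a -> exists2 b, S b & gtriple b = tinv a).

Definition cycline (mu : epath E) (g : G) (nu : epath E) : Prop :=
  psc mu = vact A g (psc nu) /\
  forall (x : ipath E) (c1 : psc mu = irg (iact A g x)) (c2 : psc nu = irg x),
    icat c1 = icat c2.

Definition Ssym : set (groupoid A) :=
  [set a | exists mu g, cycline mu g mu /\ gcyl A mu g mu a].

End Subgroupoids.

Arguments Iso {G E} A _.
Arguments Ssym {G E} A _.

(* Main.v *)
Require Import Defs.
From mathcomp Require Import all_boot all_order all_algebra.
From mathcomp Require Import all_classical.
From mathcomp Require Import topology zify.

(** Near an element $a$ of the groupoid everything is governed by a single
    group element: with $a \in \mathcal{Z}(\mu,g,\nu)$, $l = |\mu|$ and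
    $n = |\nu|$, the path $r(a)$ starts with $\mu$ and $s(a)$ with $\nu$, and
    beyond these prefixes $r(a)$ is $g$ applied to the tail of $s(a)$
    ([local_form]). A cylinder through $a$ shrinks by moving edges of $s(a)$
    into $\nu$ and replacing $g$ by its restriction. Two cylinders through $a$
    involve the same germ, so their restricted group elements agree sufficiently
    far out; hence the cylinders form a basis, and for a fixed presentation
    $(l,g,n)$ of $a$ the neighbourhoods are those given by longer and longer
    prefixes of $s(a)$ ([nbhs_groupoidP]). An element lies in
    $\mathcal{S}_{\mathrm{sym}}$ exactly when it has a presentation with
    $l = n$ and $r(a) = s(a)$ in which $g$ fixes every infinite path starting
    where the prefix ends ([SsymP]).

    Suppose that every path is generic or rare, let
    $\mathcal{S}_{\mathrm{sym}} \subseteq \mathcal{S} \subseteq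
    \operatorname{Iso}(\mathcal{G})^\circ$, and let $a$ be in the closure of
    $\mathcal{S}$, with presentation $(l,g,n)$. Then $r(a) = s(a) = z$.
    If $l \ne n$, the equation saying that the tail of $z$ after $l$ edges is
    $g$ applied to the tail after $n$ edges determines $z$ from its first edges,
    as one side runs ahead of the other ([offset_unique]). Every isotropy element
    presented by $(l,g,n)$ near $a$ solves the same equation, so it is $a$ itself,
    and $a \in \mathcal{S}$. If $l = n$, then $g$ fixes the tail $x$ of $z$.
    Elements of $\mathcal{S}$ near $a$ are interior isotropy, so they provide
    paths arbitrarily close to $x$ with a neighbourhood fixed by $g$; thus $x$ is
    not $g$-rare, hence it is $g$-generic, and
    $a \in \mathcal{S}_{\mathrm{sym}}$ ([closed_of_generic_or_rare]).

    The set $\mathcal{S}_{\mathrm{sym}}$ is itself such a subgroupoid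
    ([Ssym_subgroupoid], [Ssym_sub_Iso_interior]), so it is closed as soon as all
    of them are.

    Finally, if $x$ is neither $g$-generic nor $g$-rare, then the element
    $(x;[g|_x],0;x)$ is the limit of elements $(z;[g|_z],0;z)$ for paths
    $z \to x$ having a neighbourhood fixed by $g$; these lie in
    $\mathcal{S}_{\mathrm{sym}}$. The limit does not, since comparing germs
    would show that $g$ fixes a neighbourhood of $x$
    ([generic_or_rare_of_closed]). *)

Set Implicit Arguments.
Unset Strict Implicit.
Unset Printing Implicit Defensive.

Local Open Scope classical_set_scope.

(** * Neighbourhoods from a subbase *)

(** The hypothesis [openE] is the definition of the topology generated by [B],
    so that it holds by conversion for spaces built from a subbase. *)
Lemma open_subbase (T : topologicalType) (B : set (set T))
    (openE : @open T =
       [set \bigcup_(V in D) V | D in subset^~ (finI_from B id)]) (U : set T) :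
  B U -> open U.
Proof.
move=> BU; rewrite openE; exists [set U]; last by rewrite bigcup_set1.
by move=> _ ->; exact: finI_from1.
Qed.

(** A decreasing sequence of neighbourhoods is a local base as soon as it
    refines the subbase: the sets that it enters form a filter, so finite
    intersections come for free. *)
Lemma nbhs_subbase_chain (T : topologicalType) (B : set (set T))
    (openE : @open T =
       [set \bigcup_(V in D) V | D in subset^~ (finI_from B id)])
    (x : T) (C : nat -> set T) :
  (forall m, nbhs x (C m)) -> (forall m n, m <= n -> C n `<=` C m) ->
  (forall U, B U -> U x -> exists m, C m `<=` U) ->
  forall U, nbhs x U <-> exists m, C m `<=` U.
Proof.
move=> nC homC CB U; split=> [|[m] /filterS]; last exact.
pose F := [set V : set T | exists m, C m `<=` V].
have FF : Filter F.
  split; first by exists 0.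
    move=> V W [m mV] [n nW]; exists (maxn m n) => y Cy.
    by split; [apply/mV/homC/Cy/leq_maxl|apply/nW/homC/Cy/leq_maxr].
  by move=> V W VW [m mV]; exists m; apply: subset_trans VW.
rewrite nbhsE => -[O [oO Ox] OU]; move: oO; rewrite openE => -[D DB DO].
move: Ox; rewrite -DO => -[V DV Vx].
have [J JB JV] := DB _ DV.
suff [m mV] : F V.
  by exists m => y /mV Vy; apply: OU; rewrite -DO; exists V.
move: Vx; rewrite -JV => Vx; apply: filter_bigI => W JW.
by apply: CB (Vx _ JW); apply/set_mem/JB.
Qed.

(** * Tails of infinite paths *)

Section Paths.
Context {E : digraph}.
Implicit Types (x y z : ipath E) (mu : epath E).

Definition itail x n : ipath E :=
  IPath (fun k => x (n + k))
    (fun k => etrans (iedgeP x (n + k)) (congr1 (@rg E \o x) (esym (addnS n k)))).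

Lemma itailD x m n : itail x (m + n) = itail (itail x m) n.
Proof. by apply: ipath_eq => k /=; rewrite addnA. Qed.

Lemma itail0 x : itail x 0 = x.
Proof. by apply: ipath_eq. Qed.

Lemma irg_itail x n : irg (itail x n) = rg (x n).
Proof. by rewrite /irg /= addn0. Qed.

Lemma seg_itail x n p q : seg (itail x n) p q = seg x (n + p) (n + q).
Proof.
apply: epath_eq => //=; rewrite subnDl iotaDl -map_comp.
by apply: eq_map => k.
Qed.

Lemma seg_eqP x y p q : p < q ->
  seg x p q = seg y p q <-> (forall k, p <= k < q -> x k = y k).
Proof.
move=> pq; split=> [/(congr1 (@pword E)) /= /eq_in_map H k kpq|H].
  by apply: H; rewrite mem_iota; lia.
apply: epath_eq => /=; first by rewrite H // leqnn.
by apply/eq_in_map => k; rewrite mem_iota => kpq; apply: H; lia.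
Qed.

(** The degenerate segments $x(r,r)$ remember a vertex, which is read off as
    the range of the edge $x_r$, or as the source of the preceding edge when
    $r$ is the end of the longer segment. *)
Lemma seg_le x y p q r s : p <= r -> r <= s -> s <= q ->
  seg x p q = seg y p q -> seg x r s = seg y r s.
Proof.
move=> pr rs sq; case: (ltngtP p q) => [pq| |pq]; last 2 first.
- by move=> qp; have := leq_trans (leq_trans pr rs) sq; rewrite leqNgt qp.
- by have [-> ->] : r = p /\ s = q by split; lia.
move=> H; have /seg_eqP {}H := H; move: H => /(_ pq) H.
move: rs sq; rewrite leq_eqVlt => /orP[/eqP<- sq|rs sq]; last first.
  by apply/seg_eqP => // k krs; apply: H; lia.
have rgr : rg (x r) = rg (y r).
  move: sq; rewrite leq_eqVlt => /orP[/eqP rq|rq]; last by rewrite H ?pr.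
  case: r pr rq => [|r] pr rq; first by lia.
  by rewrite -!iedgeP H //; lia.
by apply: epath_eq; rewrite //= subnn.
Qed.

Lemma seg_glue x y m n : m <= n ->
  seg x 0 m = seg y 0 m -> seg x m n = seg y m n -> seg x 0 n = seg y 0 n.
Proof.
case: n => [|n mn xy0 xy]; first by rewrite leqn0 => /eqP->.
apply/seg_eqP => // k; case: (ltnP k m) => km kn.
  by have /seg_eqP := xy0; apply; lia.
by have /seg_eqP := xy; apply; lia.
Qed.

Lemma ipath_split x y n :
  seg x 0 n = seg y 0 n -> itail x n = itail y n -> x = y.
Proof.
move=> sxy txy; apply: ipath_eq => k.
case: (ltnP k n) => kn.
  by apply: (proj1 (@seg_eqP x y 0 n (leq_ltn_trans (leq0n k) kn)) sxy).
by have := congr1 (fun z : ipath E => z (k - n)) txy; rewrite /= subnKC.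
Qed.

Lemma ipath_segP x y : (forall n, seg x 0 n = seg y 0 n) -> x = y.
Proof.
move=> H; apply: ipath_eq => k.
by apply: (proj1 (@seg_eqP x y 0 k.+1 isT) (H k.+1)); rewrite leqnn.
Qed.

Lemma plen_seg x p q : plen (seg x p q) = q - p.
Proof. by rewrite /plen /= size_map size_iota. Qed.

Lemma seg_icat mu x (c : psc mu = irg x) : seg (icat c) 0 (plen mu) = mu.
Proof.
apply: epath_eq => /=; last first.
  rewrite subn0; apply: (@eq_from_nth _ (x 0)) => [|i].
    by rewrite size_map size_iota.
  rewrite size_map size_iota => il.
  by rewrite (nth_map 0) ?size_iota // nth_iota //= /icat_edge il.
rewrite /icat_edge; case: mu c => v [|e w] vw /= c.
  by rewrite /plen /= subnn; apply/esym.
by move: (vw) => /= /andP[/eqP].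
Qed.

Lemma itail_icat mu x (c : psc mu = irg x) : itail (icat c) (plen mu) = x.
Proof.
apply: ipath_eq => k /=; rewrite /icat_edge ltnNge leq_addr /=.
by rewrite addKn.
Qed.

Lemma icat_unique mu x z (c : psc mu = irg x) :
  seg z 0 (plen mu) = mu -> itail z (plen mu) = x -> z = icat c.
Proof.
by move=> s t; apply: (@ipath_split _ _ (plen mu)); rewrite ?seg_icat ?itail_icat.
Qed.

Lemma pcylP mu z : pcyl mu z <-> seg z 0 (plen mu) = mu.
Proof.
split=> [[x [c ->]]|s]; first exact: seg_icat.
have c : psc mu = irg (itail z (plen mu)) by rewrite -{1}s psc_seg // irg_itail.
by exists (itail z (plen mu)), c; apply: icat_unique.
Qed.

Lemma pcyl_segP x n z : pcyl (seg x 0 n) z <-> seg z 0 n = seg x 0 n.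
Proof. by rewrite pcylP plen_seg subn0. Qed.

Lemma nbhs_ipathP x (U : set (ipath E)) :
  nbhs x U <-> exists n, forall z, seg z 0 n = seg x 0 n -> U z.
Proof.
apply: (@nbhs_subbase_chain _ (range (@pcyl E)) _ x
  (fun n => [set z | seg z 0 n = seg x 0 n])) => //.
- move=> n; apply: open_nbhs_nbhs; split=> //.
  suff -> : [set z | seg z 0 n = seg x 0 n] = pcyl (seg x 0 n).
    by apply: (@open_subbase _ (range (@pcyl E))) => //; exists (seg x 0 n).
  by apply/seteqP; split=> z /pcyl_segP.
- by move=> m n mn z /=; apply: seg_le.
- move=> _ [mu _ <-] /pcylP s; exists (plen mu) => z /= sz.
  by apply/pcylP; rewrite sz.
Qed.

(** Prepending a segment of another path, with the junction condition stated
    on vertices. *)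
Lemma ipath_glue x y n : irg y = rg (x n) ->
  exists z, seg z 0 n = seg x 0 n /\ itail z n = y.
Proof.
move=> yx; have c : psc (seg x 0 n) = irg y by rewrite psc_seg.
have pl : plen (seg x 0 n) = n by rewrite plen_seg subn0.
by exists (icat c); split; [move: (seg_icat c)|move: (itail_icat c)]; rewrite pl.
Qed.

End Paths.

(** * Tails of the action *)

Section Action.
Context {G : groupType} {E : digraph} (A : self_similar G E).
Implicit Types (x y z w : ipath E) (g h : G).

Lemma segnn x n : seg x n n = pvert (rg (x n)).
Proof. by apply: epath_eq; rewrite //= subnn. Qed.

Lemma ires0 g x : ires A g x 0 = g.
Proof. by rewrite /ires segnn res_vert. Qed.

Lemma ires_itail g x m n :
  ires A (ires A g x m) (itail x m) n = ires A g x (m + n).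
Proof. by rewrite /ires seg_itail addn0 -res_seg // leq_addr. Qed.

Lemma seg_iact0 g x n : seg (iact A g x) 0 n = act A g (seg x 0 n).
Proof. by rewrite seg_iact // -/(ires A g x 0) ires0. Qed.

Lemma itail_iact g x n :
  itail (iact A g x) n = iact A (ires A g x n) (itail x n).
Proof.
apply: ipath_segP => k; rewrite seg_iact0 !seg_itail addn0.
by rewrite seg_iact // leq_addr.
Qed.

Lemma irg_iact g x : irg (iact A g x) = vact A g (irg x).
Proof. by rewrite /irg /= rg_iact_edge -/(ires A g x 0) ires0. Qed.

Lemma iactM g h x : iact A (g * h)%g x = iact A g (iact A h x).
Proof. by apply: ipath_segP => n; rewrite !seg_iact0 actM. Qed.

Lemma iact1 x : iact A 1%g x = x.
Proof. by apply: ipath_segP => n; rewrite seg_iact0 act1. Qed.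

Lemma iactK g x : iact A g^-1%g (iact A g x) = x.
Proof. by rewrite -iactM mulVg iact1. Qed.

Lemma iresM g h x n :
  ires A (g * h)%g x n = (ires A g (iact A h x) n * ires A h x n)%g.
Proof. by rewrite /ires resM seg_iact0. Qed.

Lemma iresV g x n : ires A g^-1%g (iact A g x) n = (ires A g x n)^-1%g.
Proof.
have /mulg1_eq <- : (ires A g^-1 (iact A g x) n * ires A g x n = 1)%g.
  by rewrite -iresM mulVg /ires res1.
by rewrite invgK.
Qed.

(** The action of $g$ on the paths through a cylinder $\mu E^\infty$ with
    $g \cdot \mu = \mu$ is that of $g|_\mu$ on $s(\mu)E^\infty$; so fixing a
    neighbourhood is a condition on one vertex and one group element. *)
Definition trivial_at g (v : vert E) : Prop :=
  forall x, irg x = v -> iact A g x = x.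

Lemma trivial_at_ires g x n : seg (iact A g x) 0 n = seg x 0 n ->
  trivial_at (ires A g x n) (rg (x n)) <->
  (forall z, seg z 0 n = seg x 0 n -> iact A g z = z).
Proof.
move=> gx; split=> [triv z zx|fix_z y yx].
  apply: (@ipath_split _ _ _ n); first by rewrite seg_iact0 zx -seg_iact0.
  rewrite itail_iact /ires zx; apply: triv.
  by rewrite irg_itail -(psc_seg z (leq0n n)) zx psc_seg.
have [z [zx <-]] := ipath_glue yx.
by rewrite /ires -zx -/(ires A g z n) -itail_iact fix_z.
Qed.

Lemma trivial_at_tail g x n :
  trivial_at g (irg x) -> trivial_at (ires A g x n) (rg (x n)).
Proof.
move=> triv; apply/trivial_at_ires; first by rewrite triv.
move=> z zx; apply: triv.
by rewrite -[irg z]/(prg (seg z 0 n)) zx.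
Qed.

Lemma fixes_nbhdP g x : iact A g x = x ->
  fixes_nbhd A g x <-> exists n, trivial_at (ires A g x n) (rg (x n)).
Proof.
move=> gx; split=> [[U /nbhs_ipathP [n nU] fixU]|[n]].
  exists n; apply/trivial_at_ires; first by rewrite gx.
  by move=> z /nU /fixU.
rewrite trivial_at_ires ?gx // => fix_z.
exists [set z | seg z 0 n = seg x 0 n] => //.
by apply/nbhs_ipathP; exists n.
Qed.

(** For $n < l$ the equation makes the edges of $w$ in positions below
    $l + j + 1$ depend only on those below $n + j + 1 \le l + j$, so they are
    determined one after the other by the first $l$. *)
Lemma contraction_unique l n g w z : n < l ->
  seg w 0 l = seg z 0 l ->
  itail w l = iact A g (itail w n) -> itail z l = iact A g (itail z n) ->
  w = z.
Proof.
move=> nl wz gw gz; apply: (@ipath_split _ _ _ l) => //.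
suff H j : seg w 0 (l + j) = seg z 0 (l + j).
  by apply: ipath_segP => j; rewrite !seg_itail; apply: seg_le (H j); lia.
elim: j => [|j IH]; first by rewrite addn0.
apply: seg_glue wz _; first exact: leq_addr.
have tE u : seg u l (l + j.+1) = seg (itail u l) 0 j.+1.
  by rewrite seg_itail addn0.
rewrite !tE gw gz !seg_iact0 !seg_itail addn0; congr (act A g).
by apply: seg_le IH; lia.
Qed.

(** When $l < n$, applying $g^{-1}$ exchanges the roles of $l$ and $n$. *)
Lemma offset_unique l n g w z : l <> n ->
  seg w 0 l = seg z 0 l -> seg w 0 n = seg z 0 n ->
  itail w l = iact A g (itail w n) -> itail z l = iact A g (itail z n) ->
  w = z.
Proof.
move=> /eqP; rewrite neq_ltn => /orP[ln|nl] wzl wzn gw gz; last first.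
  exact: contraction_unique nl wzl gw gz.
by apply: (contraction_unique ln wzn (g := g^-1%g)); rewrite ?gw ?gz iactK.
Qed.

End Action.

(** * Local forms of groupoid elements *)

Section LocalForm.
Context {G : groupType} {E : digraph} (A : self_similar G E).
Implicit Types (x y z w : ipath E) (g h : G) (t u : @triple G E).

(** The part of membership in $\mathcal{Z}(\mu,g,\nu)$ that involves only the
    lengths $l = |\mu|$ and $n = |\nu|$; what is left is that $\mu$ and $\nu$ are
    prefixes of the two paths, see [tcylP]. *)
Definition local_form t (l : nat) g (n : nat) : Prop :=
  [/\ tdeg t = (l%:Z - n%:Z)%R,
      itail (tl t) l = iact A g (itail (tr t) n) &
      tgerm t = germ_shift l%:Z (germ_of (ires A g (itail (tr t) n)))].

(** Truncated subtraction differs from the shift only at the first $l$ places,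
    which a germ does not see. *)
Lemma shiftE (f : nat -> G) (l : nat) :
  germ_shift l%:Z (germ_of f) = germ_of (fun p => f (p - l)).
Proof.
rewrite germ_shiftE; apply/germP; exists l => // p /= lp.
by rewrite /shift lez_nat lp; congr f; lia.
Qed.

Lemma germ_of_shift_inj (f h : nat -> G) (l : nat) :
  germ_shift l%:Z (germ_of f) = germ_shift l%:Z (germ_of h) ->
  exists m, f m = h m.
Proof.
rewrite !shiftE => /germP [N _ fh]; exists N.
by have := fh (N + l) (leq_addr _ _); rewrite addnK.
Qed.

(** Lengthening both prefixes by $m$ edges replaces $g$ by its restriction.
    The first conjunct makes this reversible: it is the information on $g$ that
    restriction loses. *)
Lemma local_form_shift t l g n m :
  local_form t l g n <->
  seg (tl t) l (l + m) = act A g (seg (tr t) n (n + m)) /\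
  local_form t (l + m) (res A g (seg (tr t) n (n + m))) (n + m).
Proof.
have resE : res A g (seg (tr t) n (n + m)) = ires A g (itail (tr t) n) m.
  by rewrite /ires seg_itail addn0.
have germE : germ_shift (l + m)%:Z (germ_of (ires A
    (ires A g (itail (tr t) n) m) (itail (itail (tr t) n) m))) =
    germ_shift l%:Z (germ_of (ires A g (itail (tr t) n))).
  rewrite !shiftE; apply/germP; exists (l + m) => // p /= lp.
  by rewrite ires_itail; congr (ires _ _ _ _); lia.
rewrite resE /local_form !itailD germE.
split=> [[-> tlE ->]|[segE [-> tlE ->]]].
  split; last by split; rewrite ?tlE ?itail_iact //; lia.
  have := congr1 (fun z : ipath E => seg z 0 m) tlE.
  by rewrite seg_iact0 !seg_itail !addn0.
split=> //; first lia.
apply: (@ipath_split _ _ _ m); last by rewrite itail_iact.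
by rewrite seg_iact0 !seg_itail !addn0.
Qed.

(** Equal germs agree at some index, and that is where restrictions of the
    two group elements coincide. *)
Lemma local_form_agree t l g h n : local_form t l g n -> local_form t l h n ->
  exists m, res A g (seg (tr t) n (n + m)) = res A h (seg (tr t) n (n + m)).
Proof.
move=> [_ _ tg] [_ _]; rewrite tg => /germ_of_shift_inj [m gh]; exists m.
by move: gh; rewrite /ires seg_itail addn0.
Qed.

Lemma local_form_inj t u l g n : local_form t l g n -> local_form u l g n ->
  seg (tl t) 0 l = seg (tl u) 0 l -> tr t = tr u -> t = u.
Proof.
case: t u => [a q k b] [a' q' k' b'] [/= -> ta ->] [/= -> ua ->] s bb; subst.
by congr Triple; apply: (ipath_split s); rewrite ta ua.
Qed.

Lemma tcylP (mu nu : epath E) g t :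
  tcyl A mu g nu t <->
  [/\ seg (tl t) 0 (plen mu) = mu, seg (tr t) 0 (plen nu) = nu &
      local_form t (plen mu) g (plen nu)].
Proof.
split=> [[x [c1 [c2 ->]]]|[smu snu [td tlE tg]]].
  by split; rewrite /= ?seg_icat //; split; rewrite /= ?itail_icat.
have c2 : psc nu = irg (itail (tr t) (plen nu)).
  by rewrite -{1}snu psc_seg // irg_itail.
have c1 : psc mu = irg (iact A g (itail (tr t) (plen nu))).
  by rewrite -tlE -{1}smu psc_seg // irg_itail.
exists (itail (tr t) (plen nu)), c1, c2.
rewrite -(icat_unique c1 smu tlE) -(icat_unique c2 snu erefl).
by rewrite -tg -td; case: (t).
Qed.

Lemma tcyl_psc (mu nu : epath E) g t :
  tcyl A mu g nu t -> psc mu = vact A g (psc nu).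
Proof. by move=> [x [c1 [c2 _]]]; rewrite c1 c2 irg_iact. Qed.

Lemma tcyl_seg l n g t u :
  tcyl A (seg (tl t) 0 l) g (seg (tr t) 0 n) u <->
  [/\ seg (tl u) 0 l = seg (tl t) 0 l, seg (tr u) 0 n = seg (tr t) 0 n &
      local_form u l g n].
Proof. by rewrite tcylP !plen_seg !subn0. Qed.

Lemma local_form_groupoid t l g n : local_form t l g n -> in_groupoid A t.
Proof.
move=> tlgn; have tC : tcyl A (seg (tl t) 0 l) g (seg (tr t) 0 n) t.
  exact/tcyl_seg.
exists (seg (tl t) 0 l), g, (seg (tr t) 0 n).
by split; first exact: tcyl_psc tC.
Qed.

Lemma groupoid_local_form (a : groupoid A) :
  exists l g n, local_form a l g n.
Proof.
have [mu [g [nu [_ /tcylP [_ _]]]]] := groupoidP a.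
by exists (plen mu), g, (plen nu).
Qed.

Lemma groupoid_eq (a b : groupoid A) : gtriple a = gtriple b -> a = b.
Proof.
case: a b => [t tP] [u uP] /= tu; subst.
by congr Groupoid; apply: Prop_irrelevance.
Qed.

(** Supplies the points of a cylinder: the source path [w] is free, while [x]
    only contributes the prefix of the range path. *)
Lemma local_form_exists x l g n w : rg (x l) = vact A g (rg (w n)) ->
  exists a : groupoid A,
    [/\ tr a = w, seg (tl a) 0 l = seg x 0 l & local_form a l g n].
Proof.
move=> c; have gw : irg (iact A g (itail w n)) = rg (x l).
  by rewrite irg_iact irg_itail.
have [z [zx ztl]] := ipath_glue gw.
pose t := Triple z (germ_shift l%:Z (germ_of (ires A g (itail w n))))
  (l%:Z - n%:Z)%R w.
have tP : local_form t l g n by [].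
by exists (Groupoid (local_form_groupoid tP)).
Qed.

(** * Neighbourhoods in the groupoid *)

(** The cylinder through $a$ with prefixes of lengths $l + m$ and $n + m$,
    see [boxE]. Keeping the presentation $(l,g,n)$ fixed avoids restrictions of
    group elements; the prefix of the range path need only be prescribed up
    to $l$, as the next $m$ edges are the image under $g$ of those of the source
    path. *)
Definition box (a : groupoid A) l g n m : set (groupoid A) :=
  [set u : groupoid A | [/\ local_form u l g n, seg (tl u) 0 l = seg (tl a) 0 l &
    seg (tr u) 0 (n + m) = seg (tr a) 0 (n + m)]].

Lemma box_tl (a u : groupoid A) l g n m :
  local_form a l g n -> box a l g n m u ->
  seg (tl u) 0 (l + m) = seg (tl a) 0 (l + m).
Proof.
move=> /(local_form_shift _ _ _ _ m) [atl _].
move=> [/(local_form_shift _ _ _ _ m) [utl _] ul ur].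
apply: seg_glue ul _; first exact: leq_addr.
by rewrite utl atl; congr (act A g); apply: seg_le ur; lia.
Qed.

Lemma boxE (a : groupoid A) l g n m : local_form a l g n ->
  box a l g n m = gcyl A (seg (tl a) 0 (l + m))
    (res A g (seg (tr a) n (n + m))) (seg (tr a) 0 (n + m)).
Proof.
move=> aP; apply/seteqP; split=> u.
  move=> ubox; apply/tcyl_seg.
  split; first exact: box_tl ubox.
    by case: ubox.
  have [/(local_form_shift _ _ _ _ m) [_ uP] _ ur] := ubox.
  by rewrite -(seg_le _ _ _ ur) //; lia.
move=> /tcyl_seg [ul ur uP].
have urn : seg (tr u) n (n + m) = seg (tr a) n (n + m).
  by apply: seg_le ur; lia.
split=> //; last by apply: seg_le ul; lia.
apply/(local_form_shift _ _ _ _ m); rewrite urn; split=> //.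
have /(local_form_shift _ _ _ _ m) [<- _] := aP.
by apply: seg_le ul; lia.
Qed.

(** With $l' = |\mu|$ and $n' = |\nu|$, both presentations of $a$ are brought to
    the common lengths $l + l'$ and $n + l' = n' + l$, and then further until the
    group elements agree. A nearby element inherits the presentation at that
    depth, and climbs back to the lengths of the given cylinder because the
    prefixes that [local_form_shift] asks for are those of $a$. *)
Lemma box_sub_gcyl (a : groupoid A) l g n mu h nu :
  local_form a l g n -> gcyl A mu h nu a ->
  exists m, box a l g n m `<=` gcyl A mu h nu.
Proof.
set l' := plen mu; set n' := plen nu.
move=> aP /tcylP; rewrite -/l' -/n' => -[amu anu aP'].
have degE : n' + l = n + l' by case: aP => e _ _; case: aP' => e' _ _; lia.
have /(local_form_shift _ _ _ _ l') [_ aP1] := aP.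
have /(local_form_shift _ _ _ _ l) [atl aP1'] := aP'.
have degE' : l' + l = l + l' by rewrite addnC.
rewrite degE degE' in atl aP1'.
have [m hm] := local_form_agree aP1 aP1'.
have /(local_form_shift _ _ _ _ m) [atl' _] := aP1'.
exists (l' + m) => u ubox.
have utl := box_tl aP ubox; have [uP _ utr] := ubox.
rewrite !addnA in utl utr.
have segr p q : p <= q -> q <= n + l' + m -> seg (tr u) p q = seg (tr a) p q.
  by move=> pq qm; apply: seg_le utr.
have segl p q : p <= q -> q <= l + l' + m -> seg (tl u) p q = seg (tl a) p q.
  by move=> pq qm; apply: seg_le utl.
apply/tcylP; rewrite -/l' -/n'; split.
- by rewrite segl //; lia.
- by rewrite segr //; lia.
apply/(local_form_shift _ _ _ _ l); rewrite degE degE'.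
rewrite segl ?segr ?atl; try lia; split=> //.
apply/(local_form_shift _ _ _ _ m).
rewrite segl ?segr ?atl' -?hm; try lia; split=> //.
have /(local_form_shift _ _ _ _ l') [_ /(local_form_shift _ _ _ _ m) [_]] := uP.
by rewrite !segr //; lia.
Qed.

Lemma nbhs_groupoidP (a : groupoid A) l g n (U : set (groupoid A)) :
  local_form a l g n -> nbhs a U <-> exists m, box a l g n m `<=` U.
Proof.
move=> aP; apply: (@nbhs_subbase_chain _ (gcyls A)) => //.
- move=> m; apply: open_nbhs_nbhs; split; last by split.
  apply: (@open_subbase _ (gcyls A)) => //.
  have : box a l g n m a by split.
  rewrite (boxE m aP) => aC.
  by do 3![eexists]; split; first exact: tcyl_psc aC.
- by move=> m k mk u [uP ul ur]; split=> //; apply: seg_le ur; lia.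
- by move=> _ [mu [h [nu [_ ->]]]]; exact: box_sub_gcyl.
Qed.

End LocalForm.

(** * Symmetric cycline triples *)

Section SymmetricCycline.
Context {G : groupType} {E : digraph} (A : self_similar G E).
Implicit Types (x y z w : ipath E) (g h : G) (t u : @triple G E).

(** The presentations witnessing membership in
    $\mathcal{S}_{\mathrm{sym}}$, see [SsymP] *)
Definition sym_form t n g : Prop :=
  [/\ local_form A t n g n, tl t = tr t & trivial_at A g (rg (tr t n))].

Lemma SsymP (a : groupoid A) : Ssym A a <-> exists n g, sym_form a n g.
Proof.
split=> [[mu [g [[fix_mu cyc] /tcylP [al ar aP]]]]|[n [g [aP lr triv]]]].
  exists (plen mu), g; have triv : trivial_at A g (rg (tr a (plen mu))).
    move=> x; rewrite -(psc_seg (tr a) (leq0n _)) ar => xmu.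
    have c1 : psc mu = irg (iact A g x) by rewrite irg_iact xmu.
    by rewrite -(itail_icat c1) (cyc x c1 (esym xmu)) itail_icat.
  split=> //; case: aP => _ tlE _.
  apply: (@ipath_split _ _ _ (plen mu)); first by rewrite al ar.
  by rewrite tlE triv // irg_itail.
have aC : tcyl A (seg (tr a) 0 n) g (seg (tr a) 0 n) a.
  by rewrite -{1}lr; apply/tcyl_seg.
exists (seg (tr a) 0 n), g; split=> //; split; first exact: tcyl_psc aC.
move=> x c1 c2; apply: icat_unique; first exact: seg_icat.
by rewrite itail_icat triv // -c2 psc_seg.
Qed.

Lemma sym_form_shift t n g m : sym_form t n g ->
  exists h, sym_form t (n + m) h.
Proof.
move=> [tP lr triv]; have [_ tP'] := proj1 (local_form_shift _ _ _ _ _ m) tP.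
eexists; split; [exact: tP'|by []|].
have /(trivial_at_tail (n := m)) : trivial_at A g (irg (itail (tr t) n)).
  by rewrite irg_itail.
by rewrite /ires seg_itail addn0.
Qed.

Lemma sym_form_groupoid t n g : sym_form t n g ->
  exists2 a : groupoid A, Ssym A a & gtriple a = t.
Proof.
move=> tP; have [tL _ _] := tP.
exists (Groupoid (local_form_groupoid tL)) => //.
by apply/SsymP; exists n, g.
Qed.

(** Two elements of $\mathcal{S}_{\mathrm{sym}}$ over the same path can be
    presented with prefixes of the same length, and then the group elements
    multiply. *)
Lemma Ssym_subgroupoid : subgroupoid (Ssym A).
Proof.
split=> [a b /SsymP [n [g aS]] /SsymP [n' [h bS]]|a /SsymP [n [g]]].
  move=> /(congr1 (@tl G E)) /= ab.
  have [g' [[da tla ga] la ta]] := sym_form_shift n' aS.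
  have [h' []] := sym_form_shift n bS.
  rewrite (addnC n' n) => -[db tlb gb] lb tb.
  rewrite la ab lb in tla; rewrite ab lb in ga ta; rewrite lb in tlb.
  apply: (@sym_form_groupoid _ (n + n') (g' * h')%g); split=> /=.
  - split=> /=; first by rewrite da db; lia.
      by rewrite la ab lb iactM -tlb.
    have -> : tdeg a = Posz 0 by rewrite da; lia.
    rewrite ga gb !shiftE [LHS]germ_mulE; congr germ_of.
    by apply/funext => p; rewrite subn0 iresM -tlb.
  - by rewrite la ab.
  - by move=> x xv; rewrite iactM tb ?ta.
move=> [[da tla ga] la ta]; rewrite la in tla.
apply: (@sym_form_groupoid _ n g^-1%g); split=> //=; last first.
- by move=> x xv; rewrite -{1}(ta x) ?iactK // -la.
rewrite /tinv; have -> : (- tdeg a)%R = Posz 0 by rewrite da; lia.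
split=> //=; first by lia.
  by rewrite la {2}tla iactK.
rewrite ga shiftE [X in germ_shift _ X]germ_invE (shiftE _ 0) shiftE la.
congr germ_of; apply/funext => p.
by rewrite subn0 [in RHS]tla iresV.
Qed.

Lemma Ssym_sub_Iso_interior : Ssym A `<=` (Iso A)°.
Proof.
move=> a /SsymP [n [g [aP lr triv]]].
apply/(nbhs_groupoidP _ aP); exists 0 => u [[_ tlE _] ul]; rewrite addn0 => ur.
congr tunit; apply: (@ipath_split _ _ _ n); first by rewrite ul ur lr.
by rewrite tlE triv // irg_itail -!(psc_seg _ (leq0n n)) ur.
Qed.

End SymmetricCycline.

(** * Rarity and closures *)

Section Closure.
Context {G : groupType} {E : digraph} (A : self_similar G E).
Implicit Types (x y z w : ipath E) (g h : G).

Lemma IsoP (a : groupoid A) : Iso A a <-> tl a = tr a.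
Proof. by split=> [/(congr1 (@tl G E))|e] //; congr tunit. Qed.

(** The range and source paths of $a$ are approximated on any finite number
    of edges by those of one and the same element of $S$. *)
Lemma closure_Iso (S : set (groupoid A)) (a : groupoid A) :
  S `<=` Iso A -> closure S a -> tl a = tr a.
Proof.
move=> SI aS; have [l [g [n aP]]] := groupoid_local_form a.
apply: ipath_segP => p.
have /aS [b [/SI/IsoP blr bbox]] : nbhs a (box a l g n p).
  by apply/(nbhs_groupoidP _ aP); exists p.
have tlab := box_tl aP bbox; case: bbox => _ _ trab.
have -> : seg (tl a) 0 p = seg (tl b) 0 p by apply/esym/seg_le/tlab; lia.
by rewrite blr; apply: seg_le trab; lia.
Qed.

(** Changing the tail of the source path of $b$ gives nearby elements, which
    are isotropy; that they are says that $g$ fixes the new tail. *)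
Lemma Iso_interior_fixes (b : groupoid A) n g :
  local_form A b n g n -> (Iso A)° b -> fixes_nbhd A g (itail (tr b) n).
Proof.
move=> bP /(nbhs_groupoidP _ bP) [m boxI].
exists [set y | seg y 0 m = seg (itail (tr b) n) 0 m].
  by apply/nbhs_ipathP; exists m.
move=> y /=; rewrite seg_itail addn0 => ym.
have [w [wb wy]] : exists w, seg w 0 n = seg (tr b) 0 n /\ itail w n = y.
  apply: ipath_glue; rewrite -[irg y]/(prg (seg y 0 m)) ym.
  by [].
have rgb : rg (tl b n) = vact A g (rg (w n)).
  have [_ tlE _] := bP.
  rewrite -!irg_itail tlE irg_iact !irg_itail.
  by rewrite -!(psc_seg _ (leq0n n)) wb.
have [u [uw ul uP]] := local_form_exists rgb.
have /boxI/IsoP ulr : box b n g n m u.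
  split=> //; rewrite uw; apply: seg_glue wb _; first exact: leq_addr.
  by rewrite -ym -wy seg_itail addn0.
have [_ + _] := uP; rewrite ulr uw wy; exact: esym.
Qed.

(** Rarity excludes points of the closure presented with $l = n$ unless $g$ is
    trivial near the tail, and uniqueness of solutions handles $l \ne n$. *)
Lemma closed_of_generic_or_rare (S : set (groupoid A)) :
  (forall g x, generic A g x \/ rare A g x) ->
  Ssym A `<=` S -> S `<=` (Iso A)° -> closed S.
Proof.
move=> gen_rare symS SI a aS.
have SIso : S `<=` Iso A by move=> b /SI /nbhs_singleton.
have alr := closure_Iso SIso aS.
have [l [g [n aP]]] := groupoid_local_form a.
have meet m : exists2 b, S b & box a l g n m b.
  have /aS [b [Sb bbox]] : nbhs a (box a l g n m).
    by apply/(nbhs_groupoidP _ aP); exists m.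
  by exists b.
(* For l <> n an element of S close to a is a itself. *)
have [ln|ln] := eqVneq l n; last first.
  have [b Sb [bP bl br]] := meet 0.
  have /IsoP blr := SIso _ Sb.
  have tab : tr b = tr a.
    have [_ gb _] := bP; have [_ ga _] := aP; rewrite addn0 in br.
    apply: (offset_unique (elimN eqP ln) _ br); first by rewrite -blr bl alr.
    - by rewrite -{1}blr; exact: gb.
    - by rewrite -{1}alr; exact: ga.
  by rewrite -(groupoid_eq (local_form_inj bP aP bl tab)).
subst l; apply: symS.
set x := itail (tr a) n.
have gx : iact A g x = x by have [_ ga _] := aP; rewrite -ga alr.
case: (gen_rare g x) => [[//|/(fixes_nbhdP gx) [m triv]]|[_ [N not_fix]]].
  apply/SsymP; exists (n + m), (ires A g x m); split=> //.
    have [_] := proj1 (local_form_shift _ _ _ _ _ m) aP.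
    by rewrite /ires seg_itail addn0.
have [b Sb [bP bl br]] := meet N.
case: (not_fix (itail (tr b) n)); last exact: Iso_interior_fixes bP (SI _ Sb).
apply/pcyl_segP; rewrite !seg_itail addn0; apply: seg_le br; lia.
Qed.

(** A path that is neither generic nor rare yields a point that is in the
    closure of $\mathcal{S}_{\mathrm{sym}}$ but not in it. *)
Lemma generic_or_rare_of_closed :
  closed (Ssym A) -> forall g x, generic A g x \/ rare A g x.
Proof.
move=> clS g x.
have [gx|] := pselect (iact A g x = x); last by left; left.
have [|not_rare] := pselect (rare A g x); first by right.
left; right.
have elem z : iact A g z = z -> exists a : groupoid A,
    [/\ tr a = z, tl a = z & local_form A a 0 g 0].
  move=> gz; have c : rg (iact A g z 0) = vact A g (rg (z 0)) by exact: irg_iact.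
  have [a [az al aP]] := local_form_exists c; exists a; split=> //.
  by have [_ + _] := aP; rewrite !itail0 az gz.
(* The limit point $(x;[g|_x],0;x)$. *)
have [a [atr atl aP]] := elem x gx.
have /clS /SsymP [n [h [ahP _ htriv]]] : closure (Ssym A) a.
  move=> U /(nbhs_groupoidP _ aP) [m boxU].
  have [z zx fix_z] : exists2 z, seg z 0 m = seg x 0 m & fixes_nbhd A g z.
    apply: contrapT => no_z; apply: not_rare; split=> //; exists m => z.
    by move=> /pcyl_segP zx fix_z; apply: no_z; exists z.
  have gz : iact A g z = z.
    by case: fix_z => V /nbhs_singleton Vz; apply.
  have [b [btr btl bP]] := elem z gz.
  exists b; split; last first.
    apply: boxU; split; rewrite // ?btr ?btl ?atr ?atl ?add0n //.
    exact: seg_le zx.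
  have /(fixes_nbhdP gz) [k triv] := fix_z.
  apply/SsymP; exists k, (ires A g z k); rewrite /sym_form btr btl; split=> //.
  have [_] := proj1 (local_form_shift _ _ _ _ _ k) bP.
  by rewrite !add0n btr.
(* Agreement of the germs of g at x and of the witness h of membership. *)
have [_ agP] := proj1 (local_form_shift _ _ _ _ _ n) aP.
rewrite !add0n in agP.
have [m] := local_form_agree agP ahP.
rewrite atr => agree; apply/(fixes_nbhdP gx); exists (n + m).
rewrite /ires (res_seg _ _ _ (leq_addr m n)) agree.
have /(trivial_at_tail (n := m)) : trivial_at A h (irg (itail x n)).
  by rewrite irg_itail -atr.
by rewrite /ires seg_itail addn0.
Qed.

End Closure.

Theorem theorem5p20 (G : groupType) (E : digraph) (A : self_similar G E)
  (G_countable : countable [set: G])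
  (G_infinite_order : exists g : G, forall n : nat, 0 < n -> (g ^+ n)%g <> 1%g)
  (E_no_sources : no_sources E)
  (A_pseudo_free : pseudo_free A) :
  ((forall (g : G) (x : ipath E), generic A g x \/ rare A g x) <->
   (forall S : set (groupoid A),
      subgroupoid S -> Ssym A `<=` S -> S `<=` (Iso A)° -> closed S)) /\
  ((forall S : set (groupoid A),
      subgroupoid S -> Ssym A `<=` S -> S `<=` (Iso A)° -> closed S) <->
   closed (Ssym A)).
Proof.
have H12 : (forall (g : G) (x : ipath E), generic A g x \/ rare A g x) ->
    forall S : set (groupoid A),
      subgroupoid S -> Ssym A `<=` S -> S `<=` (Iso A)° -> closed S.
  by move=> gr S _; exact: closed_of_generic_or_rare.
have H23 : (forall S : set (groupoid A),
      subgroupoid S -> Ssym A `<=` S -> S `<=` (Iso A)° -> closed S) ->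
    closed (Ssym A).
  by apply=> //; [exact: Ssym_subgroupoid|exact: Ssym_sub_Iso_interior].
have H31 := @generic_or_rare_of_closed _ _ A.
split; split=> // H; first exact: H31 (H23 H).
exact: H12 (H31 H).
Qed.
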